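(* Let $G$ be a network and let $G'$ be a (nonfanout) inflation of $G$. If the family of states $\{\rho_{\bm{U}}:\bm{U}\in\mathsf{ImagesInjectableSets}(G)\}$ is compatible with $G$, then the family of states $\{\sigma_{\bm{Y}'}:\bm{Y}'\in\mathsf{ExpressibleSets}(G')\}$, where $$\sigma_{\bm{Y}'}:=\bigotimes_{j=1}^{y}\rho_{\bm{U}_{(j)}}$$ with $\bm{U}'_{(1)},\dots,\bm{U}'_{(y)}$ the injectable components of $\bm{Y}'$, $\bm{U}_{(j)}$ the image of $\bm{U}'_{(j)}$, and the $j$-th factor regarded as a state on the systems $\bm{U}'_{(j)}$, is compatible with $G'$.
   Context: All Hilbert spaces are finite-dimensional. A network $G$ is a directed acyclic graph whose nodes are partitioned into visible nodes $\mathsf{Vnodes}(G)$ and latent nodes $\mathsf{Lnodes}(G)$, with all edges going from latent to visible nodes. $\mathrm{Pa}$ and $\mathrm{Ch}$ denote parents and children. Compatibility of a state. Each visible node $A$ carries a given Hilbert space $\mathcal{H}_A$. A state $\rho$ on $\bigotimes_{A\in\mathsf{Vnodes}(G)}\mathcal{H}_A$ is $G$-compatible if for each latent node $L$ there are finite-dimensional spaces $\mathcal{H}_{L^{(A)}}$, $A\in\mathrm{Ch}(L)$, and a state $\rho_L$ on $\bigotimes_{A\in\mathrm{Ch}(L)}\mathcal{H}_{L^{(A)}}$, and for each visible node $A$ a quantum channel (completely positive trace-preserving map) $\mathcal{E}_A$ from operators on $\bigotimes_{L\in\mathrm{Pa}(A)}\mathcal{H}_{L^{(A)}}$ to operators on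 $\mathcal{H}_A$, such that $\rho=\big(\bigotimes_{A}\mathcal{E}_A\big)\big(\bigotimes_{L}\rho_L\big)$. A family of states $\{\rho_{\bm{X}}\}$ indexed by subsets $\bm{X}$ of visible nodes is compatible with $G$ if there is a $G$-compatible state on all the visible nodes whose reduced state on $\bm{X}$ is $\rho_{\bm{X}}$ for every $\bm{X}$ in the index family. Inflation. Consider a directed acyclic graph $G'$ with visible and latent nodes, together with a surjective map (''dropping copy indices'') from nodes of $G'$ to nodes of $G$ taking visible nodes to visible nodes and latent nodes to latent nodes; nodes of $G'$ mapped to $A$ are called copies of $A$ and written $A_i$. The ancestral subgraph of a set of nodes is the induced subgraph on that set together with all ancestors of its elements. For sets of nodes $\bm{U}'$ of $G'$ and $\bm{U}$ of $G$, write $\mathsf{ansubgraph}_{G'}(\bm{U}')\sim\mathsf{ansubgraph}_G(\bm{U})$ if dropping copy indices restricts to a bijection $\bm{U}'\to\bm{U}$ and to a graph isomorphism from the ancestral subgraph of $\bm{U}'$ in $G'$ to that of $\bm{U}$ in $G$. $G'$ is an inflation of $G$ if $\mathsf{ansubgraph}_{G'}(\{A_i\})\sim\mathsf{ansubgraph}_G(\{A\})$ for every node $A_i$ of $G'$ (so $G'$ is itself a network). It is nonfanout if no latent node of $G'$ has two distinct children that are copies of the same visible node of $G$. Each visible node $A_i$ of $G'$ carries a copy of the Hilbert space $\mathcal{H}_A$. A set $\bm{U}'\subseteq\mathsf{Vnodes}(G')$ is injectable if there is $\bm{U}\subseteq\mathsf{Vnodes}(G)$ with $\mathsf{ansubgraph}_{G'}(\bm{U}')\sim\mathsf{ansubgraph}_G(\bm{U})$;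 $\bm{U}$ is then the image of $\bm{U}'$. $\mathsf{ImagesInjectableSets}(G)$ is the set of all images of injectable sets of $G'$. A set $\bm{Y}'\subseteq\mathsf{Vnodes}(G')$ is expressible, $\bm{Y}'\in\mathsf{ExpressibleSets}(G')$, if $\bm{Y}'=\bigcup_{j=1}^y\bm{U}'_{(j)}$ with each $\bm{U}'_{(j)}$ injectable and the ancestral subgraphs of the $\bm{U}'_{(j)}$ in $G'$ pairwise disjoint; for each expressible $\bm{Y}'$ fix such a decomposition and call the $\bm{U}'_{(j)}$ its injectable components. *)

(* Defs.v *)
From mathcomp Require Import all_boot all_order all_algebra.
From mathcomp Require Import complex reals.

Set Implicit Arguments.
Unset Strict Implicit.
Unset Printing Implicit Defensive.

Import Order.TTheory GRing.Theory Num.Theory.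
Local Open Scope ring_scope.
Local Open Scope sesquilinear_scope.

(* A finite-dimensional Hilbert space is given by a finite type I indexing an  *)
(* orthonormal basis.  An operator on it is a square matrix of size #|I|, and  *)
(* ent / opmx pass between matrices and coefficients indexed by I through      *)
(* enum_rank / enum_val.  The tensor product of the spaces with bases T i has  *)
(* the multi-indices {dffun forall i, T i} as its product basis.               *)
Notation op C I := 'M[C]_(#|{: I}|).

Lemma dffun_distr (C : comNzRingType) (K : finType) (T : K -> finType)
    (F : forall k, T k -> C) :
  \prod_k \sum_(t : T k) F k t =
  \sum_(m : {dffun forall k, T k}) \prod_k F k (m k).
Proof.
rewrite (reindex (@dffun_of_fprod K T)) /=; last exact/onW_bij/dffun_of_fprod_bij.
pose P k : {ffun T k -> C} := [ffun t => F k t].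
transitivity (\prod_k \sum_(t : T k) P k t).
  by apply: eq_bigr => k _; apply: eq_bigr => t _; rewrite ffunE.
transitivity (\sum_(m : fprod T) \prod_k P k (m k)); last first.
  by apply: eq_bigr => m _; apply: eq_bigr => k _; rewrite !ffunE.
rewrite (big_fprod 1 +%R P).
under eq_bigr do rewrite (big_tag (fun i t => P i t)).
rewrite (bigA_distr_big_dep _ (fun k j => untag 0 (P k) j)).
exact: eq_bigl.
Qed.

Section Operators.
Variable C : numClosedFieldType.

Definition ent (I : finType) (A : op C I) (i j : I) : C :=
  A (enum_rank i) (enum_rank j).

Definition opmx (I : finType) (F : I -> I -> C) : op C I :=
  \matrix_(i, j) F (enum_val i) (enum_val j).

Lemma opmxE (I : finType) (F : I -> I -> C) i j : ent (opmx F) i j = F i j.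
Proof. by rewrite /ent mxE !enum_rankK. Qed.

Lemma entP (I : finType) (A B : op C I) : ent A =2 ent B -> A = B.
Proof.
move=> eAB; apply/matrixP => i j.
by have := eAB (enum_val i) (enum_val j); rewrite /ent !enum_valK.
Qed.

(* In a numClosedFieldType, 0 <= z says that z is real and nonnegative, so     *)
(* that Hermiticity follows.                                                   *)
Definition psd n (A : 'M[C]_n) : Prop :=
  forall v : 'cV[C]_n, 0 <= (v ^t* *m A *m v) 0 0.

Definition is_state n (A : 'M[C]_n) : Prop := psd A /\ \tr A = 1.

(* E (x) id on operators on H (x) C^k: E acts on each of the k * k blocks.     *)
Definition ampliation (I J : finType) (k : nat) (E : op C I -> op C J)
    (X : op C (I * 'I_k)%type) : op C (J * 'I_k)%type :=
  opmx (fun p q : J * 'I_k =>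
    ent (E (opmx (fun i i' : I => ent X (i, p.2) (i', q.2)))) p.1 q.1).

Definition completely_positive (I J : finType) (E : op C I -> op C J) : Prop :=
  forall (k : nat) (X : op C (I * 'I_k)%type), psd X -> psd (ampliation E X).

Definition trace_preserving (I J : finType) (E : op C I -> op C J) : Prop :=
  forall X : op C I, \tr (E X) = \tr X.

Definition is_channel (I J : finType) (E : {linear op C I -> op C J}) : Prop :=
  completely_positive E /\ trace_preserving E.

Definition tensor_op (K : finType) (T : K -> finType)
    (A : forall k, op C (T k)) : op C {dffun forall k, T k} :=
  opmx (fun m n : {dffun forall k, T k} => \prod_k ent (A k) (m k) (n k)).

(* The tensor product of the linear maps E k: the matrix unit |i><i'| of the   *)
(* product basis is the tensor product of the matrix units |i k><i' k|, hence  *)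
(* is sent to the tensor product of the operators E k |i k><i' k|.             *)
Definition tensor_map (K : finType) (S T : K -> finType)
    (E : forall k, op C (S k) -> op C (T k))
    (X : op C {dffun forall k, S k}) : op C {dffun forall k, T k} :=
  \sum_(i : {dffun forall k, S k}) \sum_(i' : {dffun forall k, S k})
    ent X i i' *:
      tensor_op (fun k => E k (delta_mx (enum_rank (i k)) (enum_rank (i' k)))).

Lemma op_sum (I : finType) (A : op C I) :
  A = \sum_i \sum_i' ent A i i' *: delta_mx (enum_rank i) (enum_rank i').
Proof.
rewrite [LHS]matrix_sum_delta (reindex enum_rank) /=; last exact/onW_bij/enum_rank_bij.
apply: eq_bigr => i _; rewrite (reindex enum_rank) //=.
exact/onW_bij/enum_rank_bij.
Qed.

Lemma tensor_map_tensor_op (K : finType) (S T : K -> finType)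
    (E : forall k, {linear op C (S k) -> op C (T k)})
    (X : forall k, op C (S k)) :
  tensor_map (fun k => E k) (tensor_op X) = tensor_op (fun k => E k (X k)).
Proof.
apply: entP => m n.
have entD (J Q : finType) (r : seq Q) (H : Q -> op C J) a b :
  ent (\sum_(q <- r) H q) a b = \sum_(q <- r) ent (H q) a b by rewrite /ent summxE.
rewrite opmxE /tensor_map.
transitivity (\sum_(i : {dffun forall k, S k}) \sum_(i' : {dffun forall k, S k})
   \prod_k (ent (X k) (i k) (i' k) *
     ent (E k (delta_mx (enum_rank (i k)) (enum_rank (i' k)))) (m k) (n k))).
  rewrite entD; apply: eq_bigr => i _; rewrite entD; apply: eq_bigr => i' _.
  by rewrite {1}/ent mxE -!/(ent _ _ _) !opmxE -big_split.
transitivity (\sum_(i : {dffun forall k, S k}) \prod_k \sum_(t : S k)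
   (ent (X k) (i k) t *
     ent (E k (delta_mx (enum_rank (i k)) (enum_rank t))) (m k) (n k))).
  apply: eq_bigr => i _; rewrite -(dffun_distr (fun k (t : S k) => ent (X k) (i k) t *
    ent (E k (delta_mx (enum_rank (i k)) (enum_rank t))) (m k) (n k))).
  by [].
rewrite -(dffun_distr (fun k s => \sum_t ent (X k) s t *
  ent (E k (delta_mx (enum_rank s) (enum_rank t))) (m k) (n k))).
apply: eq_bigr => k _; rewrite [in RHS](op_sum (X k)) linear_sum entD.
apply: eq_bigr => s _; rewrite linear_sum entD; apply: eq_bigr => t _.
by rewrite linearZ /= [in RHS]/ent mxE.
Qed.

(* Change of basis labels along h; only used for bijective h.                  *)
Definition relabel (I J : finType) (h : J -> I) (A : op C I) : op C J :=
  opmx (fun j j' => ent A (h j) (h j')).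

End Operators.

Section SystemsOverSubsets.
Variables (V : finType) (d : V -> nat).

(* Basis of the tensor product over a in X of spaces of dimension d a.         *)
Definition sidx (X : {set V}) : finType :=
  {dffun forall a : {a : V | a \in X}, 'I_(d (val a))}.

Definition fullidx : finType := {dffun forall a : V, 'I_(d a)}.

Definition restr_full (X : {set V}) (m : fullidx) : sidx X :=
  [ffun a : {a : V | a \in X} => m (val a)].

Definition restr (X Y : {set V}) (sXY : X \subset Y) (m : sidx Y) : sidx X :=
  [ffun a : {a : V | a \in X} =>
     m (exist (fun b => b \in Y) (val a) (subsetP sXY _ (valP a)))].

(* The reduced operator on X: trace over the systems outside X.                *)
Definition reduced (C : numClosedFieldType) (X : {set V}) (A : op C fullidx) :
    op C (sidx X) :=
  opmx (fun m n : sidx X =>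
    \sum_(k : fullidx | restr_full X k == m)
    \sum_(k' : fullidx | (restr_full X k' == n) &&
                         (restr_full (~: X) k == restr_full (~: X) k'))
      ent A k k').

End SystemsOverSubsets.

Record dag := Dag {
  vnode : finType;
  lnode : finType;
  edge : rel (vnode + lnode)%type;
  acyclic : forall x y, edge x y -> ~~ connect edge y x }.

Definition node (G : dag) : finType := (vnode G + lnode G)%type.

Definition is_network (G : dag) : Prop :=
  forall x y : node G, edge x y ->
    exists (L : lnode G) (A : vnode G), x = inr L /\ y = inl A.

Definition ancestral (G : dag) (U : {set node G}) : {set node G} :=
  [set x | [exists u in U, connect (@edge G) x u]].

Section Compatibility.
Variable G : dag.

(* In a network all the parents of a visible node are latent and all the       *)
(* children of a latent node are visible.                                      *)
Definition Pa (A : vnode G) : {set lnode G} := [set L | edge (inr L) (inl A)].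
Definition Ch (L : lnode G) : {set vnode G} := [set A | edge (inr L) (inl A)].

Lemma Ch_Pa (L : lnode G) (A : vnode G) : A \in Ch L -> L \in Pa A.
Proof. by rewrite !inE. Qed.

Variable dl : lnode G -> vnode G -> nat.

(* With dl L A the dimension of the space sent by L to A, paidx A is the basis *)
(* of the input of A and chidx L that of the output of L.                      *)
Definition paidx (A : vnode G) : finType := sidx (fun L => dl L A) (Pa A).
Definition chidx (L : lnode G) : finType := sidx (dl L) (Ch L).

(* Identifies the tensor product over A, then over L in Pa A, with the tensor  *)
(* product over L, then over A in Ch L.                                        *)
Definition regroup (m : {dffun forall A : vnode G, paidx A}) :
    {dffun forall L : lnode G, chidx L} :=
  [ffun L : lnode G => [ffun A : {A : vnode G | A \in Ch L} =>
     m (val A) (exist (fun L' => L' \in Pa (val A)) L (Ch_Pa (valP A)))]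
       : chidx L].

End Compatibility.

Definition compatible (C : numClosedFieldType) (G : dag) (d : vnode G -> nat)
    (rho : op C (fullidx d)) : Prop :=
  exists (dl : lnode G -> vnode G -> nat)
         (rhoL : forall L : lnode G, op C (chidx dl L))
         (E : forall A : vnode G, {linear op C (paidx dl A) -> op C 'I_(d A)}),
    [/\ forall L, is_state (rhoL L),
        forall A, is_channel (E A)
      & rho = tensor_map (T := fun A => 'I_(d A)) (fun A => E A)
                (relabel (@regroup G dl) (tensor_op rhoL))].

(* A family of operators indexed by the sets X of visible nodes satisfying P.  *)
Definition compatible_family (C : numClosedFieldType) (G : dag)
    (d : vnode G -> nat) (P : {set vnode G} -> Prop)
    (fam : forall X : {set vnode G}, P X -> op C (sidx d X)) : Prop :=
  exists rho : op C (fullidx d),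
    [/\ is_state rho, compatible rho
      & forall (X : {set vnode G}) (hX : P X), reduced X rho = fam X hX].

Section Inflation.
Variables G' G : dag.

(* A map of nodes that respects the partition into visible and latent nodes.   *)
Record copymap := CopyMap {
  onV : vnode G' -> vnode G;
  onL : lnode G' -> lnode G }.

Definition drop_copy (f : copymap) (x : node G') : node G :=
  match x with inl A => inl (onV f A) | inr L => inr (onL f L) end.

Variable f : copymap.

Definition anc_sim (U' : {set node G'}) (U : {set node G}) : Prop :=
  [/\ {in U' &, injective (drop_copy f)},
      drop_copy f @: U' = U,
      {in ancestral U' &, injective (drop_copy f)},
      drop_copy f @: ancestral U' = ancestral U
    & {in ancestral U' &, forall x y,
         edge (drop_copy f x) (drop_copy f y) = edge x y}].

Definition is_inflation : Prop :=
  (forall y : node G, exists x : node G', drop_copy f x = y) /\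
  (forall x : node G', anc_sim [set x] [set drop_copy f x]).

Definition nonfanout : Prop :=
  forall (L : lnode G') (A B : vnode G'),
    edge (inr L) (inl A) -> edge (inr L) (inl B) -> A <> B -> onV f A <> onV f B.

Definition vis (H : dag) (U : {set vnode H}) : {set node H} :=
  [set inl A | A in U].

(* U' is injectable and U is its image.                                        *)
Definition image_of (U' : {set vnode G'}) (U : {set vnode G}) : Prop :=
  anc_sim (vis U') (vis U).

Definition images_injectable (U : {set vnode G}) : Prop :=
  exists U' : {set vnode G'}, image_of U' U.

(* The injectable components of an expressible set, with their images.         *)
Record decomposition (Y : {set vnode G'}) := Decomposition {
  ncomp : nat;
  component : 'I_ncomp -> {set vnode G'};
  comp_image : 'I_ncomp -> {set vnode G};
  cover_component : Y = \bigcup_j component j;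
  comp_imageP : forall j, image_of (component j) (comp_image j);
  disjoint_component : forall i j, i != j ->
    [disjoint ancestral (vis (component i)) & ancestral (vis (component j))] }.

Arguments component {Y} D j : rename.
Arguments comp_image {Y} D j : rename.
Arguments comp_imageP {Y} D j : rename.

Definition expressible (Y : {set vnode G'}) : Prop :=
  inhabited (decomposition Y).

Lemma image_ofP U' U (A : vnode G') :
  image_of U' U -> A \in U' -> onV f A \in U.
Proof.
case=> _ eU _ _ _ AU'.
have: drop_copy f (inl A) \in vis U by rewrite -eU imset_f // imset_f.
by case/imsetP=> B BU [->].
Qed.

Lemma comp_sub Y (D : decomposition Y) j : component D j \subset Y.
Proof. by case: D j => n c im e ? ? j /=; rewrite e (bigcup_sup j). Qed.

Lemma comp_image_in Y (D : decomposition Y) j :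
  images_injectable (comp_image D j).
Proof. by exists (component D j); apply: comp_imageP. Qed.

Arguments comp_sub {Y} D j.
Arguments comp_image_in {Y} D j.

Lemma inflation_network : is_network G -> is_inflation -> is_network G'.
Proof.
move=> hG [_ hf] x y exy; have [_ _ _ _ hE] := hf y.
have ax : x \in ancestral [set y].
  by rewrite inE; apply/existsP; exists y; rewrite inE eqxx connect1.
have ay : y \in ancestral [set y].
  by rewrite inE; apply/existsP; exists y; rewrite inE eqxx connect0.
have := hE _ _ ax ay; rewrite exy {hE} => /hG [L [A []]].
by case: x {exy ax} => // L'; case: y {ay} => // A'; exists L', A'.
Qed.

Variables (C : numClosedFieldType) (d : vnode G -> nat).

(* A copy of A carries a copy of the space of A.                               *)
Definition copydim (A : vnode G') : nat := d (onV f A).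

(* The multi-indices over an injectable set U' correspond to those over its    *)
(* image U.  image_pull is the bijection from U to U', and on_copies A is the  *)
(* operator A on the systems U regarded as an operator on the systems U'.      *)
Definition image_pull U' U (h : image_of U' U) (m : sidx d U) :
    sidx copydim U' :=
  [ffun a : {a : vnode G' | a \in U'} =>
     m (exist (fun b => b \in U) (onV f (val a)) (image_ofP h (valP a)))].

Lemma image_pull_inj U' U (h : image_of U' U) : injective (image_pull h).
Proof.
move=> m n /ffunP emn; apply/ffunP => -[a aU].
have: inl a \in vis U by rewrite imset_f.
case: (h) => _ <- _ _ _ /imsetP [x /imsetP [a' a'U ->]] /= [ea]; subst a.
have := emn (exist _ a' a'U); rewrite !ffunE /=.
by rewrite (bool_irrelevance (image_ofP _ _) aU).
Qed.

Definition on_copies U' U (h : image_of U' U) (A : op C (sidx d U)) :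
    op C (sidx copydim U') :=
  opmx (fun m' n' : sidx copydim U' =>
    \sum_(m : sidx d U | image_pull h m == m')
    \sum_(n : sidx d U | image_pull h n == n') ent A m n).

Lemma on_copiesE U' U (h : image_of U' U) (A : op C (sidx d U)) m n :
  ent (on_copies h A) (image_pull h m) (image_pull h n) = ent A m n.
Proof.
by rewrite opmxE (big_pred1 m) ?(big_pred1 n) // => k;
  rewrite (inj_eq (@image_pull_inj _ _ h)).
Qed.

(* The tensor product of the operators rho (comp_image D j), the j-th one      *)
(* regarded as an operator on the systems component D j.                       *)
Definition product_op
    (rho : forall U : {set vnode G}, images_injectable U -> op C (sidx d U))
    (Y : {set vnode G'}) (D : decomposition Y) : op C (sidx copydim Y) :=
  opmx (fun m n : sidx copydim Y =>
    \prod_(j < ncomp D)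
      ent (on_copies (comp_imageP D j)
             (rho (comp_image D j) (comp_image_in D j)))
          (restr (comp_sub D j) m) (restr (comp_sub D j) n)).

End Inflation.

(* Main.v *)
(* Given dl, rhoL and E for G, every latent L' of G' sends to its child A' the *)
(* space that its image sends to the image of A', A' applies the channel of    *)
(* its image, and L' emits the partial trace of the state of its image over    *)
(* the children that have no copy below L'.  Expanding the output into a sum   *)
(* over pairs of basis configurations of the latent states, the systems        *)
(* outside Y' disappear by trace preservation, and what is left is a product   *)
(* of local factors, in which each latent without a child in Y' contributes 1. *)
(* As the ancestral subgraphs of the injectable components are disjoint and    *)
(* isomorphic to those of their images, the sum factors accordingly.           *)
Require Import Defs.
From HB Require Import structures.
From mathcomp Require Import all_boot all_order all_algebra.
From mathcomp Require Import complex reals.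
From mathcomp Require Import ring.
Import Order.TTheory GRing.Theory Num.Theory.
Local Open Scope ring_scope.

Set Implicit Arguments.
Unset Strict Implicit.
Unset Printing Implicit Defensive.

(** Every copy imitates its original. A latent copy prepares the state of the latent it copies and
    discards the systems meant for children it lacks. A visible copy applies the original channel,
    which makes sense because the parents of a copy biject with those of the original
    ([in_pull_bij]). Nonfanout ensures that no emitted system is claimed by two children.

    The marginal of this model on [Y] is a sum, over pairs of basis emissions of the latents, of
    products of local terms ([copy_output_reduced]). A latent enters through the partial trace of
    its state onto its children in [Y], a visible node of [Y] through one entry of the Choi matrix
    of its channel. The term of a latent above no component sums to the trace of its state, which is
    1. Every other latent is above exactly one injectable component, and there the isomorphism of
    ancestral subgraphs identifies its term with one of the model on [G]. [sum_coupling] turns this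
    local matching into a product over the components ([copy_output_factor]). The model on [G] is
    the same construction along the identity ([copy_output_id]), so each factor is a marginal of the
    given compatible state.

    Positivity of the output ([copy_output_is_state]) rests on [tensor_map_psd]: Choi matrices of
    completely positive maps are Gram kernels, and these are closed under entrywise products and
    contractions. *)

(** * Positive semidefinite kernels *)

(* Gram kernels rather than psd matrices: closure under pullback, pointwise    *)
(* product and contraction is then immediate.                                 *)
Definition gram (C : numClosedFieldType) (I : finType) (F : I -> I -> C) : Prop :=
  exists (J : finType) (x : J -> I -> C),
    forall i i', F i i' = \sum_j x j i * (x j i')^*.

Section Gram.
Variable C : numClosedFieldType.
Implicit Types I K : finType.

Lemma gram_psd I (F : I -> I -> C) : gram F -> psd (opmx F).
Proof.
case=> J [x eF] v; rewrite mxE.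
have -> : \sum_j (map_mx Num.conj v^T *m opmx F) 0 j * v j 0 =
    \sum_l (\sum_i (v i 0)^* * x l (enum_val i)) *
           (\sum_i (v i 0)^* * x l (enum_val i))^*.
  transitivity (\sum_j \sum_i \sum_l
     ((v i 0)^* * x l (enum_val i)) * ((v j 0)^* * x l (enum_val j))^*).
    apply: eq_bigr => j _; rewrite mxE mulr_suml; apply: eq_bigr => i _.
    rewrite !mxE eF mulr_sumr mulr_suml; apply: eq_bigr => l _.
    by rewrite rmorphM /= conjCK -!mulrA; do 2 congr (_ * _); rewrite mulrC.
  rewrite exchange_big /=; under eq_bigr do rewrite exchange_big /=.
  rewrite exchange_big; apply: eq_bigr => l _.
  rewrite mulr_suml; apply: eq_bigr => i _.
  by rewrite rmorph_sum mulr_sumr.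
by apply: sumr_ge0 => l _; apply: mul_conjC_ge0.
Qed.

Lemma psd_form n (A : 'M[C]_n) (v : 'cV[C]_n) : psd A ->
  0 <= \sum_i \sum_j (v i 0)^* * A i j * v j 0.
Proof.
move=> /(_ v); rewrite mxE; congr (0 <= _).
rewrite exchange_big; apply: eq_bigr => j _.
by rewrite mxE mulr_suml; apply: eq_bigr => i _; rewrite !mxE.
Qed.

(** Polarization: on vectors supported on the coordinates i and j the form is real, hence so is
    [c * A i j + c^* * A j i] for every c; the cases c = 1 and c = 'i determine [A j i]. *)
Lemma psd_hermitian n (A : 'M[C]_n) : psd A -> forall i j, A j i = (A i j)^*.
Proof.
move=> pA.
have form2 i j (a b : C) : i != j ->
    0 <= a^* * A i i * a + a^* * A i j * b + (b^* * A j i * a + b^* * A j j * b).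
  move=> nij; pose v : 'cV[C]_n := \col_k (if k == i then a else if k == j then b else 0).
  have vi : v i 0 = a by rewrite mxE eqxx.
  have vj : v j 0 = b by rewrite mxE eq_sym (negPf nij) eqxx.
  have v0 k : k != i -> k != j -> v k 0 = 0.
    by move=> /negPf ki /negPf kj; rewrite mxE ki kj.
  have := @psd_form n A v pA.
  have sum2 (F : 'I_n -> C) : (forall k, k != i -> k != j -> F k = 0) ->
      \sum_k F k = F i + F j.
    move=> F0; rewrite (bigD1 i) //= (bigD1 j) 1?eq_sym //= big1 ?addr0 //.
    by move=> k /andP[]; apply: F0.
  rewrite sum2 => [|k ki kj]; last by apply: big1 => l _; rewrite v0 // conjC0 !mul0r.
  rewrite !sum2 ?vi ?vj // => k ki kj; by rewrite v0 // mulr0.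
have diag_real i : 0 <= A i i.
  pose v : 'cV[C]_n := delta_mx i 0.
  have := @psd_form n A v pA.
  rewrite (bigD1 i) //= [X in _ + X]big1 ?addr0 => [|k ki]; last first.
    by apply: big1 => l _; rewrite mxE (negPf ki) /= conjC0 !mul0r.
  rewrite (bigD1 i) //= [X in _ + X]big1 ?addr0 => [|k ki]; last first.
    by rewrite [v k 0]mxE (negPf ki) mulr0.
  by rewrite mxE !eqxx /= conjC1 mul1r mulr1.
move=> i j; have [<-|nij] := eqVneq i j; first by rewrite conj_Creal // ger0_real.
have real_cross (c : C) : c * A i j + c^* * A j i \is Num.real.
  have h := @form2 i j 1 c nij.
  have hc : c^* * A j j * c \is Num.real.
    by rewrite mulrAC ger0_real // mulr_ge0 // mulrC mul_conjC_ge0.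
  have hi : A i i \is Num.real by rewrite ger0_real.
  rewrite conjC1 !mul1r !mulr1 in h.
  have -> : c * A i j + c^* * A j i =
     (A i i + A i j * c + (c^* * A j i + c^* * A j j * c)) - A i i - c^* * A j j * c.
    by ring.
  by rewrite !rpredB // ger0_real.
have /CrealP := real_cross 1; have /CrealP := real_cross 'i.
rewrite !rmorphD !rmorphM /= !conjCK !conjC1 !mul1r conjCi !mulNr.
set x := A i j; set y := A j i => h1 h2.
have {}h1 : y^* - x^* = x - y.
  by apply: (mulfI (neq0Ci C)); rewrite !mulrBr [LHS]addrC.
have e2 : x^* *+ 2 = y *+ 2.
  have -> : x^* *+ 2 = (x^* + y^*) - (y^* - x^*) by ring.
  by rewrite h1 h2; ring.
by move/eqP: e2; rewrite eqr_pMn2r // => /eqP.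
Qed.

(** Spectral theorem: A = P^* D P with P unitary and D nonnegative, so the conjugated rows of P,
    scaled by square roots of eigenvalues, serve as Gram vectors. *)
Lemma psd_gram I (A : op C I) : psd A -> gram (ent A).
Proof.
move=> pA; have hA := @psd_hermitian _ _ pA.
have nA : A \is normalmx.
  apply/normalmxP; suff -> : map_mx Num.conj A^T = A by [].
  by apply/matrixP => i j; rewrite !mxE -hA.
set n := #|{: I}| in A pA hA nA *.
set P := spectralmx A; set D := spectral_diag A.
have uP : P \is unitarymx := spectral_unitarymx A.
have eA : A = map_mx Num.conj P^T *m diag_mx D *m P.
  by rewrite -invmx_unitary //; apply/orthomx_spectralP.
have eD : diag_mx D = P *m A *m map_mx Num.conj P^T.
  rewrite eA !mulmxA (unitarymxP uP) mul1mx -mulmxA.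
  by rewrite (unitarymxP uP) mulmx1.
have D0 l : 0 <= D 0 l.
  have := pA (map_mx Num.conj P^T *m delta_mx l 0).
  rewrite trmx_mul map_mxM /= trmx_delta map_delta_mx trmxCK -!mulmxA.
  rewrite !mulmxA -(mulmxA _ P) -(mulmxA _ (P *m A)) -eD -rowE -colE !mxE eqxx.
  by [].
exists 'I_n, (fun l i => sqrtC (D 0 l) * (P l (enum_rank i))^*) => i i'.
rewrite /ent eA mxE; apply: eq_bigr => l _.
rewrite mul_mx_diag !mxE rmorphM /= conjCK.
rewrite (conj_Creal (x := sqrtC (D 0 l))) ?ger0_real ?sqrtC_ge0 //.
by rewrite mulrACA -expr2 sqrtCK mulrA [in LHS](mulrC _ (D 0 l)).
Qed.

Lemma gram_ext I (F H : I -> I -> C) : F =2 H -> gram F -> gram H.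
Proof. by move=> e [J [x eF]]; exists J, x => i i'; rewrite -e. Qed.

Lemma psd_opmx I (F : I -> I -> C) : psd (opmx F) -> gram F.
Proof. by move/psd_gram; apply: gram_ext => i i'; rewrite opmxE. Qed.

Lemma gram_pull I I' (h : I' -> I) (F : I -> I -> C) :
  gram F -> gram (fun i i' => F (h i) (h i')).
Proof. by case=> J [x eF]; exists J, (fun j i => x j (h i)) => i i'. Qed.

Lemma gram_rank1 I (x : I -> C) : gram (fun i i' => x i * (x i')^*).
Proof. by exists unit, (fun=> x) => i i'; rewrite (big_pred1 tt) // => -[]. Qed.

(** Schur product theorem: the new Gram vectors are the entrywise products, indexed by pairs. *)
Lemma gram_mul I (F H : I -> I -> C) :
  gram F -> gram H -> gram (fun i i' => F i i' * H i i').
Proof.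
case=> J [x eF] [K [y eH]]; exists (J * K)%type, (fun p i => x p.1 i * y p.2 i).
move=> i i'; rewrite eF eH big_distrlr pair_big /=; apply: eq_bigr => p _.
by rewrite rmorphM /= mulrACA.
Qed.

Lemma gram_prod I K (F : K -> I -> I -> C) :
  (forall k, gram (F k)) -> gram (fun i i' => \prod_k F k i i').
Proof.
move=> gF; elim: (index_enum K) => [|k r IH].
  apply: gram_ext (@gram_rank1 _ (fun=> 1)) => i i'.
  by rewrite big_nil mul1r conjC1.
by apply: gram_ext (@gram_mul _ _ _ (gF k) IH) => i i'; rewrite big_cons.
Qed.

Lemma gram_eq I K (h : I -> K) : gram (fun i i' => (h i == h i')%:R : C).
Proof.
exists K, (fun k i => (h i == k)%:R) => i i'.
rewrite (bigD1 (h i)) //= big1 => [|k /negPf]; last by rewrite eq_sym => ->; rewrite mul0r.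
by rewrite eqxx mul1r addr0 eq_sym conjC_nat.
Qed.

(** The congruence W F W^* by a rectangular matrix; with 0/1 entries it sums out indices. *)
Lemma gram_contract I K (w : K -> I -> C) (F : I -> I -> C) : gram F ->
  gram (fun m n => \sum_i \sum_i' w m i * (w n i')^* * F i i').
Proof.
case=> J [x eF]; exists J, (fun j m => \sum_i w m i * x j i) => m n.
under [RHS]eq_bigr do rewrite rmorph_sum big_distrlr /=.
rewrite [RHS]exchange_big; apply: eq_bigr => i _.
rewrite [RHS]exchange_big; apply: eq_bigr => i' _.
rewrite eF mulr_sumr; apply: eq_bigr => j _.
by rewrite rmorphM /= mulrACA.
Qed.

End Gram.

(** * Tensor products of channels *)

Section TensorMap.
Variable C : numClosedFieldType.

(** The Choi matrix: the ampliation of [E] by a copy of its input space is applied to the projector,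
    up to scale, on the maximally entangled vector [x]. *)
Lemma gram_choi (I J : finType) (E : op C I -> op C J) : completely_positive E ->
  gram (fun p q : J * I =>
    ent (E (delta_mx (enum_rank p.2) (enum_rank q.2))) p.1 q.1).
Proof.
pose x (p : I * 'I_#|I|) : C := (enum_rank p.1 == p.2)%:R.
move=> /(_ _ _ (gram_psd (gram_rank1 x))) /psd_opmx gE.
pose h (p : J * I) : J * 'I_#|I| := (p.1, enum_rank p.2).
apply: gram_ext (gram_pull h gE) => p q /=; congr (ent (E _) _ _).
apply: entP => i i'; rewrite !opmxE /x /= conjC_nat /ent mxE !(inj_eq enum_rank_inj).
by rewrite -mulnb natrM.
Qed.

Lemma tensor_mapE (K : finType) (S T : K -> finType)
    (E : forall k, op C (S k) -> op C (T k)) (X : op C {dffun forall k, S k}) m n :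
  ent (tensor_map E X) m n =
  \sum_(i : {dffun forall k, S k}) \sum_(i' : {dffun forall k, S k})
    ent X i i' *
    \prod_k ent (E k (delta_mx (enum_rank (i k)) (enum_rank (i' k)))) (m k) (n k).
Proof.
rewrite /ent /tensor_map summxE; apply: eq_bigr => i _.
rewrite summxE; apply: eq_bigr => i' _.
by rewrite mxE -!/(ent _ _ _) opmxE.
Qed.

Lemma tensor_op_psd (K : finType) (T : K -> finType) (A : forall k, op C (T k)) :
  (forall k, psd (A k)) -> psd (tensor_op A).
Proof.
move=> pA; apply: gram_psd.
apply: (@gram_prod C _ K (fun k (m n : {dffun forall k, T k}) =>
  ent (A k) (m k) (n k))) => k.
exact: (gram_pull (fun m : {dffun forall k, T k} => m k) (psd_gram (pA k))).
Qed.

Lemma relabel_psd (I J : finType) (h : J -> I) (A : op C I) :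
  psd A -> psd (relabel h A).
Proof. by move=> pA; apply/gram_psd/(gram_pull h)/psd_gram. Qed.

(** The output is the entrywise product of [X] with the Choi kernels of all [E k], contracted over
    the input indices. *)
Lemma tensor_map_psd (K : finType) (S T : K -> finType)
    (E : forall k, op C (S k) -> op C (T k)) (X : op C {dffun forall k, S k}) :
  (forall k, completely_positive (E k)) -> psd X -> psd (tensor_map E X).
Proof.
move=> cpE pX.
pose P := ({dffun forall k, T k} * {dffun forall k, S k})%type.
pose Q (p q : P) : C := ent X p.2 q.2 *
  \prod_k ent (E k (delta_mx (enum_rank (p.2 k)) (enum_rank (q.2 k)))) (p.1 k) (q.1 k).
have gQ : gram Q.
  apply: gram_mul; first exact: (gram_pull (snd : P -> _) (psd_gram pX)).
  apply: (@gram_prod _ _ _ (fun k (p q : P) => ent (E k (delta_mx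
     (enum_rank (p.2 k)) (enum_rank (q.2 k)))) (p.1 k) (q.1 k))) => k.
  exact: (gram_pull (fun p : P => (p.1 k, p.2 k)) (gram_choi (cpE k))).
pose w (m : {dffun forall k, T k}) (p : P) : C := (p.1 == m)%:R.
have sum_w m (H : P -> C) : \sum_p w m p * H p = \sum_i H (m, i).
  transitivity (\sum_a \sum_b w m (a, b) * H (a, b)).
    by rewrite pair_bigA; apply: eq_bigr => -[].
  rewrite (bigD1 m) //=.
  rewrite [X in _ + X]big1 ?addr0 => [|a /negPf ham].
    by apply: eq_bigr => b _; rewrite /w eqxx mul1r.
  by apply: big1 => b _; rewrite /w /= ham mul0r.
have := gram_contract w gQ => /gram_psd; congr psd; apply: entP => m n.
rewrite opmxE tensor_mapE.
under eq_bigr => p _.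
  under eq_bigr do rewrite conjC_nat -mulrA.
  rewrite -mulr_sumr sum_w; over.
by rewrite sum_w.
Qed.

Lemma mxtrace_ent (I : finType) (A : op C I) : \tr A = \sum_i ent A i i.
Proof. by rewrite /mxtrace (reindex enum_rank) //=; last exact/onW_bij/enum_rank_bij. Qed.

Lemma trace_preserving_delta (I J : finType) (E : op C I -> op C J) i i' :
  trace_preserving E ->
  \sum_j ent (E (delta_mx (enum_rank i) (enum_rank i'))) j j = (i == i')%:R.
Proof.
move=> tE; rewrite -mxtrace_ent tE mxtrace_ent (bigD1 i) //= big1 ?addr0.
  by rewrite /ent mxE eqxx (inj_eq enum_rank_inj).
by move=> k /negPf ki; rewrite /ent mxE (inj_eq enum_rank_inj) ki.
Qed.

Lemma relabel_is_linear (I J : finType) (h : J -> I) :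
  linear (@relabel C I J h).
Proof. by move=> a A B; apply: entP => i j; rewrite opmxE /ent !mxE !enum_rankK. Qed.

(** Lets [E \o relabel h] be inferred as a linear map, the type required of [copy_channel]. *)
HB.instance Definition _ (I J : finType) (h : J -> I) :=
  GRing.isLinear.Build C (op C I) (op C J) *:%R (@relabel C I J h)
    (relabel_is_linear h).

Lemma completely_positive_relabel (I I' J : finType) (h : I -> I')
    (E : op C I -> op C J) :
  completely_positive E -> completely_positive (E \o relabel h).
Proof.
move=> cpE k X pX.
have := cpE k _ (relabel_psd (fun p : I * 'I_k => (h p.1, p.2)) pX).
congr psd; apply: entP => p q; rewrite !opmxE; congr (ent (E _) _ _).
by apply: entP => i i'; rewrite !opmxE.
Qed.

Lemma trace_preserving_relabel (I I' J : finType) (h : I -> I')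
    (E : op C I -> op C J) : bijective h ->
  trace_preserving E -> trace_preserving (E \o relabel h).
Proof.
move=> bh tE X; rewrite /= tE !mxtrace_ent [RHS](reindex h) /=; last exact: onW_bij.
by apply: eq_bigr => i _; rewrite opmxE.
Qed.

Lemma relabel_delta (I J : finType) (h : J -> I) j j' : injective h ->
  relabel h (delta_mx (enum_rank (h j)) (enum_rank (h j'))) =
  delta_mx (enum_rank j) (enum_rank j') :> op C J.
Proof.
move=> ih; apply: entP => a b; rewrite opmxE /ent !mxE.
by rewrite !(inj_eq enum_rank_inj) !(inj_eq ih).
Qed.

End TensorMap.

(** * Reduced operators of a network *)

Section Reduced.
Variable C : numClosedFieldType.

Lemma dffun_distr2 (K : finType) (S T : K -> finType) (F : forall k, S k -> T k -> C) :
  \prod_k \sum_(s : S k) \sum_(t : T k) F k s t =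
  \sum_(m : {dffun forall k, S k}) \sum_(n : {dffun forall k, T k})
    \prod_k F k (m k) (n k).
Proof.
rewrite (dffun_distr (fun k s => \sum_t F k s t)); apply: eq_bigr => m _.
exact: (dffun_distr (fun k t => F k (m k) t)).
Qed.

Lemma prod_nat_bool (I : finType) (P : pred I) (b : I -> bool) :
  \prod_(i | P i) (b i)%:R = [forall (i | P i), b i]%:R :> C.
Proof.
have [/forall_inP h|] := boolP [forall (i | P i), b i].
  by rewrite big1 // => i /h ->.
rewrite negb_forall_in => /exists_inP [i Pi /negPf bi].
by rewrite (bigD1 i) //= bi mul0r.
Qed.

Lemma restr_fullP (V : finType) (d : V -> nat) (X : {set V}) (k k' : fullidx d) :
  reflect (forall a, a \in X -> k a = k' a) (restr_full X k == restr_full X k').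
Proof.
apply: (iffP eqP) => [e a aX|e]; last by apply/ffunP => a; rewrite !ffunE e // (valP a).
by have /ffunP/(_ (exist (fun b => b \in X) a aX)) := e; rewrite !ffunE.
Qed.

(** The constraints of the partial trace become one indicator per node, ready to be distributed over
    the sums on [k] and [k']. Writing the boundary indices as restrictions avoids functions on
    subsets. *)
Lemma reduced_restr (V : finType) (d : V -> nat) (X : {set V}) (A : op C (fullidx d))
    (k0 k0' : fullidx d) :
  ent (reduced X A) (restr_full X k0) (restr_full X k0') =
  \sum_(k : fullidx d) \sum_(k' : fullidx d) ent A k k' *
    \prod_a (if a \in X then (k a == k0 a) && (k' a == k0' a) else k a == k' a)%:R.
Proof.
rewrite opmxE big_mkcond; apply: eq_bigr => k _.
transitivity (\sum_(k' : fullidx d)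
    if [&& restr_full X k == restr_full X k0, restr_full X k' == restr_full X k0'
         & restr_full (~: X) k == restr_full (~: X) k'] then ent A k k' else 0).
  by case: ifP => _; rewrite ?big1_eq // big_mkcond.
apply: eq_bigr => k' _.
rewrite prod_nat_bool -mulrb mulr_natr; congr (_ *+ nat_of_bool _).
apply/idP/forallP => /=.
  move=> /andP[/restr_fullP h1 /andP[/restr_fullP h2 /restr_fullP h3]] a.
  by case: ifPn => aX; [rewrite h1 // h2 // !eqxx | rewrite h3 // inE].
move=> h; apply/and3P; split; apply/restr_fullP => a aX; have := h a.
- by rewrite aX => /andP[/eqP].
- by rewrite aX => /andP[_ /eqP].
- by move: aX; rewrite inE => /negPf -> /eqP.
Qed.

(** For [A] outside [Y], summing over the output gives the trace of [E A] on a matrix unit, which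
    trace preservation turns into a Kronecker delta on the inputs of [A]. *)
Lemma reduced_network (G : dag) (d : vnode G -> nat) (dl : lnode G -> vnode G -> nat)
    (rhoL : forall L, op C (chidx dl L))
    (E : forall A : vnode G, op C (paidx dl A) -> op C 'I_(d A))
    (Y : {set vnode G}) (k0 k0' : fullidx d) :
  (forall A, trace_preserving (E A)) ->
  ent (reduced Y (tensor_map (T := fun A => 'I_(d A)) E
                    (relabel (@regroup G dl) (tensor_op rhoL))))
      (restr_full Y k0) (restr_full Y k0') =
  \sum_(i : {dffun forall A, paidx dl A}) \sum_(i' : {dffun forall A, paidx dl A})
    (\prod_L ent (rhoL L) (regroup i L) (regroup i' L)) *
    \prod_A (if A \in Y
             then ent (E A (delta_mx (enum_rank (i A)) (enum_rank (i' A)))) (k0 A) (k0' A)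
             else (i A == i' A)%:R).
Proof.
move=> tE; rewrite reduced_restr.
set R := relabel _ _.
pose c A (a a' : 'I_(d A)) : C :=
  (if A \in Y then (a == k0 A) && (a' == k0' A) else a == a')%:R.
pose e A i i' a a' := ent (E A (delta_mx (enum_rank i) (enum_rank i'))) a a'.
transitivity (\sum_(k : fullidx d) \sum_(k' : fullidx d)
    \sum_(i : {dffun forall A, paidx dl A}) \sum_(i' : {dffun forall A, paidx dl A})
      ent R i i' * \prod_A (e A (i A) (i' A) (k A) (k' A) * c A (k A) (k' A))).
  apply: eq_bigr => k _; apply: eq_bigr => k' _; rewrite tensor_mapE mulr_suml.
  apply: eq_bigr => i _; rewrite mulr_suml; apply: eq_bigr => i' _.
  by rewrite -mulrA -big_split.
under eq_bigr do rewrite exchange_big /=.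
rewrite exchange_big; apply: eq_bigr => i _ /=.
under eq_bigr do rewrite exchange_big /=.
rewrite exchange_big; apply: eq_bigr => i' _ /=.
rewrite !opmxE; under eq_bigr do rewrite -mulr_sumr.
rewrite -mulr_sumr; congr (_ * _).
rewrite -(dffun_distr2 (fun A a a' => e A (i A) (i' A) a a' * c A a a')).
apply: eq_bigr => A _; rewrite /c /e.
have [AY|AY] := boolP (A \in Y).
  rewrite (bigD1 (k0 A)) //= [X in _ + X]big1 ?addr0 => [|a /negPf ha]; last first.
    by apply: big1 => a' _; rewrite ha mulr0.
  rewrite (bigD1 (k0' A)) //= big1 ?addr0 => [|a' /negPf ha]; last first.
    by rewrite ha andbF mulr0.
  by rewrite !eqxx mulr1.
rewrite -(trace_preserving_delta _ _ (tE A)); apply: eq_bigr => a _.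
rewrite (bigD1 a) //= big1 ?addr0 => [|a' /negPf ha]; last first.
  by rewrite eq_sym ha mulr0.
by rewrite eqxx mulr1.
Qed.

End Reduced.

(** * The induced model on an inflation *)

Section InflatedModel.
Variables (C : numClosedFieldType) (G' G : dag) (f : copymap G' G).

(** Suffices to define the induced model, and holds by computation for the identity of [G], so that
    [G] is covered by the same formulas. *)
Definition preserves_edges : Prop := forall (L : lnode G') (A : vnode G'),
  edge (inr L) (inl A) -> edge (inr (onL f L)) (inl (onV f A)).

Hypothesis f_edge : preserves_edges.

Lemma Ch_copy L A : A \in Ch L -> onV f A \in Ch (onL f L).
Proof. by rewrite !inE; apply: f_edge. Qed.

Lemma Pa_copy A L : L \in Pa A -> onL f L \in Pa (onV f A).
Proof. by rewrite !inE; apply: f_edge. Qed.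

Lemma Pa_Ch_copy A L : L \in Pa A -> onV f A \in Ch (onL f L).
Proof. by rewrite !inE; apply: f_edge. Qed.

Variable dl : lnode G -> vnode G -> nat.

Definition copy_dl (L : lnode G') (A : vnode G') : nat := dl (onL f L) (onV f A).

(** Forgets the coordinates of the children of [onL f L] that have no copy below [L], hence is not
    injective in general. *)
Definition out_pull (L : lnode G') (z : chidx dl (onL f L)) : chidx copy_dl L :=
  [ffun A : {A : vnode G' | A \in Ch L} =>
     z (exist (fun B => B \in Ch (onL f L)) (onV f (val A)) (Ch_copy (valP A)))].

Definition in_pull (A : vnode G') (s : paidx dl (onV f A)) : paidx copy_dl A :=
  [ffun L : {L : lnode G' | L \in Pa A} =>
     s (exist (fun M => M \in Pa (onV f A)) (onL f (val L)) (Pa_copy (valP L)))].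

(** Index form of tracing out every system that is sent outside [S]. *)
Definition agree_off (S : {set vnode G}) (L : lnode G) (z z' : chidx dl L) : bool :=
  [forall B : {B : vnode G | B \in Ch L}, (val B \notin S) ==> (z B == z' B)].

Lemma agree_offP (S : {set vnode G}) (L : lnode G) (z z' : chidx dl L) :
  reflect (forall B (BL : B \in Ch L), B \notin S ->
             z (exist (fun B => B \in Ch L) B BL) = z' (exist _ B BL))
          (agree_off S z z').
Proof.
apply: (iffP forallP) => [h B BL BS|h [B BL] /=].
  by apply/eqP; have /implyP := h (exist _ B BL); apply.
by apply/implyP => BS; rewrite h.
Qed.

Lemma gram_agree_off S L :
  gram (fun z z' : chidx dl L => (agree_off S z z')%:R : C).
Proof.
pose F (B : {B : vnode G | B \in Ch L}) (z z' : chidx dl L) : C :=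
  ((val B \notin S) ==> (z B == z' B))%:R.
apply: (@gram_ext _ _ (fun z z' => \prod_B F B z z')) => [z z'|].
  by rewrite prod_nat_bool.
apply: gram_prod => B; rewrite /F.
case: (val B \notin S) => /=; first exact: gram_eq.
by apply: gram_ext (gram_rank1 (fun=> 1)) => z z'; rewrite mul1r conjC1.
Qed.

Variables (d : vnode G -> nat) (rhoL : forall L, op C (chidx dl L)).
Variable E : forall A : vnode G, {linear op C (paidx dl A) -> op C 'I_(d A)}.

(** Summed over [z], [z'] with their coordinates in [S] fixed, this is an entry of the partial trace
    of [rhoL L] onto [S]. *)
Definition weight (S : {set vnode G}) (L : lnode G) (z z' : chidx dl L) : C :=
  ent (rhoL L) z z' * (agree_off S z z')%:R.

(* The partial trace of rhoL (onL f L) over the children without a copy among *)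
(* the children of L.                                                         *)
Definition copy_state (L : lnode G') : op C (chidx copy_dl L) :=
  opmx (fun c c' => \sum_z \sum_z' (out_pull z == c)%:R * (out_pull z' == c')%:R *
    weight (onV f @: Ch L) z z').

Definition copy_channel (A : vnode G') :
    {linear op C (paidx copy_dl A) -> op C 'I_(copydim f d A)} :=
  E (onV f A) \o relabel (@in_pull A).

Definition copy_output : op C (fullidx (copydim f d)) :=
  tensor_map (T := fun A => 'I_(copydim f d A)) (fun A => copy_channel A)
    (relabel (@regroup G' copy_dl) (tensor_op copy_state)).

Lemma weight0_sum L : \tr (rhoL L) = 1 ->
  \sum_(z : chidx dl L) \sum_(z' : chidx dl L) weight set0 z z' = 1.
Proof.
move=> <-; rewrite mxtrace_ent; apply: eq_bigr => z _.
rewrite (bigD1 z) //= big1 ?addr0 => [|z' /negPf zz']; rewrite /weight.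
  by case: agree_offP => [_|[]//]; rewrite mulr1.
case: agree_offP => [h|]; last by rewrite mulr0.
case/eqP: zz'; apply/ffunP => -[B BL]; by symmetry; apply: h; rewrite inE.
Qed.

(** Positivity: [rhoL] times the Gram kernel of agreement, contracted along [out_pull]. Trace: on
    the diagonal [z] and [z'] agree on the copied children and, by [agree_off], on the others, so
    [z = z']. *)
Lemma copy_state_is_state L : is_state (rhoL (onL f L)) -> is_state (copy_state L).
Proof.
case=> pL tL; split.
  apply: gram_psd.
  pose w (c : chidx copy_dl L) (z : chidx dl (onL f L)) : C := (out_pull z == c)%:R.
  apply: gram_ext (gram_contract w
    (gram_mul (psd_gram pL) (gram_agree_off (onV f @: Ch L) (onL f L)))) => c c'.
  by apply: eq_bigr => z _; apply: eq_bigr => z' _; rewrite /w conjC_nat.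
rewrite mxtrace_ent -tL mxtrace_ent.
under eq_bigr do rewrite opmxE.
rewrite exchange_big; apply: eq_bigr => z _.
rewrite exchange_big (bigD1 z) //= [X in _ + X]big1 ?addr0 => [|z' /negPf zz'].
  rewrite (bigD1 (out_pull z)) //= big1 ?addr0 => [|c /negPf]; last first.
    by rewrite eq_sym => ->; rewrite !mul0r.
  rewrite eqxx !mul1r /weight; case: agree_offP => [_|[]//].
  by rewrite mulr1.
apply: big1 => c _; rewrite -natrM mulnb.
case: andP => [[/eqP ez /eqP ez']|]; last by rewrite mul0r.
rewrite /weight; case: agree_offP => [h|]; last by rewrite !mulr0.
case/eqP: zz'; apply/ffunP => -[B BL].
have [/imsetP [A AL eB]|BS] := boolP (B \in onV f @: Ch L); last by symmetry; apply: h.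
subst B; have /ffunP/(_ (exist (fun A => A \in Ch L) A AL)) := etrans ez' (esym ez).
by rewrite !ffunE /= (bool_irrelevance (Ch_copy _) BL).
Qed.

(** A latent copy is indexed by the whole output basis of its original, traced out systems included,
    so that configurations on [G'] and [G] can be compared. *)
Local Notation emission := {dffun forall L : lnode G', chidx dl (onL f L)}.

Definition received (Z : emission) :
    {dffun forall A : vnode G', paidx copy_dl A} :=
  [ffun A : vnode G' => [ffun L : {L : lnode G' | L \in Pa A} =>
     Z (val L) (exist (fun B => B \in Ch (onL f (val L))) (onV f A)
                 (Pa_Ch_copy (valP L)))] : paidx copy_dl A].

(** Emissions determine all inputs, so the sums over inputs can be eliminated. *)
Lemma regroup_received (Z : emission) (i : {dffun forall A : vnode G', paidx copy_dl A}) :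
  [forall L, out_pull (Z L) == regroup i L] = (i == received Z).
Proof.
apply/forallP/eqP => [h|-> L]; last first.
  apply/eqP/ffunP => A; rewrite !ffunE /=.
  by congr (Z L (exist _ _ _)); apply: bool_irrelevance.
apply/ffunP => A; apply/ffunP => -[L LA]; rewrite !ffunE /=.
have AL : A \in Ch L by move: (LA); rewrite !inE.
have /eqP/ffunP/(_ (exist (fun A => A \in Ch L) A AL)) := h L; rewrite !ffunE /=.
rewrite (bool_irrelevance (Ch_Pa _) LA) => <-.
by congr (Z L (exist _ _ _)); apply: bool_irrelevance.
Qed.

(** Tracing out the nodes outside [Y] merges with the discarding done by the latent copies. By
    nonfanout, a child outside [Y] never shares its coordinate with a child in [Y]. *)
Lemma agree_off_received (Y : {set vnode G'}) (Z Z' : emission) : nonfanout f ->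
  [forall L, agree_off (onV f @: Ch L) (Z L) (Z' L)] &&
  [forall (A | A \notin Y), received Z A == received Z' A] =
  [forall L, agree_off (onV f @: (Ch L :&: Y)) (Z L) (Z' L)].
Proof.
move=> nf; apply/andP/forallP => [[/forallP h1 /forall_inP h2] L|h].
  apply/agree_offP => B BL BY.
  have [/imsetP [A AL eB]|BS] := boolP (B \in onV f @: Ch L).
    subst B; have AY : A \notin Y.
      by apply: contra BY => AY; rewrite imset_f // inE AL.
    have LA := Ch_Pa AL.
    have /eqP/ffunP/(_ (exist (fun L => L \in Pa A) L LA)) := h2 A AY.
    by rewrite !ffunE /= (bool_irrelevance (Pa_Ch_copy _) BL).
  by have /agree_offP := h1 L; apply.
split; first apply/forallP => L.
  apply/agree_offP => B BL BS; have /agree_offP := h L; apply.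
  by apply: contra BS => /imsetP [A]; rewrite inE => /andP[AL _] ->; rewrite imset_f.
apply/forall_inP => A AY; apply/eqP/ffunP => -[L LA]; rewrite !ffunE /=.
have /agree_offP := h L; apply; apply/imsetP => -[B]; rewrite !inE => /andP[BL BY] eAB.
have AL : edge (inr L) (inl A) by move: LA; rewrite inE.
case: (eqVneq A B) => [eB|nAB]; first by rewrite eB BY in AY.
by apply: (nf L A B) => //; apply/eqP.
Qed.

Lemma copy_output_reduced (Y : {set vnode G'}) (k k' : fullidx (copydim f d)) :
  nonfanout f -> (forall A, trace_preserving (copy_channel A)) ->
  ent (reduced Y copy_output) (restr_full Y k) (restr_full Y k') =
  \sum_(Z : emission)
  \sum_(Z' : emission)
    (\prod_L weight (onV f @: (Ch L :&: Y)) (Z L) (Z' L)) *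
    \prod_(A in Y) ent (copy_channel A
      (delta_mx (enum_rank (received Z A)) (enum_rank (received Z' A)))) (k A) (k' A).
Proof.
move=> nf tE; rewrite (reduced_network copy_state _ _ _ tE).
pose e i i' := \prod_A (if A \in Y then ent (copy_channel A
  (delta_mx (enum_rank (i A)) (enum_rank (i' A)))) (k A) (k' A)
  else (i A == i' A)%:R).
transitivity (
  \sum_(i : {dffun forall A, paidx copy_dl A}) \sum_(i' : {dffun forall A, paidx copy_dl A})
  \sum_(Z : emission)
  \sum_(Z' : emission)
   (i == received Z)%:R * (i' == received Z')%:R *
   ((\prod_L weight (onV f @: Ch L) (Z L) (Z' L)) * e i i')).
  apply: eq_bigr => i _; apply: eq_bigr => i' _; rewrite -/(e i i').
  under eq_bigr do rewrite opmxE.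
  rewrite (dffun_distr2 (fun L z z' => (out_pull z == regroup i L)%:R *
    (out_pull z' == regroup i' L)%:R * weight (onV f @: Ch L) z z')) mulr_suml.
  apply: eq_bigr => Z _; rewrite mulr_suml; apply: eq_bigr => Z' _.
  by rewrite !big_split /= !prod_nat_bool !regroup_received -!mulrA.
under eq_bigr do rewrite exchange_big /=.
rewrite exchange_big; apply: eq_bigr => Z _ /=.
under eq_bigr do rewrite exchange_big /=.
rewrite exchange_big; apply: eq_bigr => Z' _ /=.
rewrite (bigD1 (received Z)) //= [X in _ + X]big1 ?addr0 => [|i /negPf hi]; last first.
  by apply: big1 => i' _; rewrite hi !mul0r.
rewrite (bigD1 (received Z')) //= [X in _ + X]big1 ?addr0 => [|i' /negPf hi]; last first.
  by rewrite hi mulr0 mul0r.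
rewrite !eqxx !mul1r /e (bigID (mem Y)) /= mulrCA [RHS]mulrC; congr (_ * _).
  by apply: eq_bigr => A ->.
rewrite (eq_bigr (fun A => (received Z A == received Z' A)%:R)) => [|A /negPf -> //].
rewrite /weight !big_split /= -mulrA; congr (_ * _).
by rewrite !prod_nat_bool -natrM mulnb agree_off_received.
Qed.

End InflatedModel.

(** * Factorization over ancestrally disjoint sets *)

Section Coupling.
Variable C : numClosedFieldType.

(** Row and column emissions become one configuration of pairs, the form that [sum_coupling]
    takes. *)
Lemma sum_dffun_pair (K : finType) (S T : K -> finType)
    (F : {dffun forall k, S k} -> {dffun forall k, T k} -> C) :
  \sum_m \sum_n F m n =
  \sum_(x : {dffun forall k, (S k * T k)%type})
    F [ffun k => (x k).1] [ffun k => (x k).2].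
Proof.
rewrite pair_bigA (reindex (fun x : {dffun forall k, (S k * T k)%type} =>
  ([ffun k => (x k).1] : {dffun forall k, S k},
   [ffun k => (x k).2] : {dffun forall k, T k}))) //=.
exists (fun p : {dffun forall k, S k} * {dffun forall k, T k} =>
  [ffun k => (p.1 k, p.2 k)]) => [x _|[m n] _].
  by apply/ffunP => k; rewrite !ffunE -surjective_pairing.
by congr (_, _); apply/ffunP => k; rewrite !ffunE.
Qed.

(* Both sides equal the sum over the pairs (x', X) that agree on S: for fixed  *)
(* x' (resp. X) the coordinates not determined by it sum to 1.  The equality  *)
(* of x' k' and X j k is written with Tagged to avoid transport along f k' = k. *)
Lemma sum_coupling (K' K J : finType) (f : K' -> K) (T : K -> finType)
    (S : J -> {set K'}) (mu : forall k, T k -> C)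
    (M' : {dffun forall k', T (f k')} -> C) (M : J -> {dffun forall k, T k} -> C) :
  (forall j, {in S j &, injective f}) ->
  (forall i j k, k \in S i -> k \in S j -> i = j) ->
  (forall k, \sum_t mu k t = 1) ->
  (forall (x' : {dffun forall k', T (f k')}) (X : J -> {dffun forall k, T k}),
     (forall j k, k \in S j -> x' k = X j (f k)) -> M' x' = \prod_j M j (X j)) ->
  \sum_x' M' x' * \prod_k (if [exists j, k \in S j] then 1 else mu (f k) (x' k)) =
  \prod_j \sum_x M j x * \prod_k (if k \in f @: S j then 1 else mu k (x k)).
Proof.
move=> f_inj S_disj mu1 eM.
set N' := fun x' : {dffun forall k', T (f k')} =>
  \prod_k (if [exists j, k \in S j] then 1 else mu (f k) (x' k)).
set N := fun j (x : {dffun forall k, T k}) =>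
  \prod_k (if k \in f @: S j then 1 else mu k (x k)).
pose D := {dffun forall k, T k}.
pose D' := {dffun forall k', T (f k')}.
pose agree (x' : D') (X : {dffun forall j : J, D}) : bool :=
  [forall j, forall (k | k \in S j), x' k == X j (f k)].
(* At k in [f @: S j] the value is forced by [x'] at the only preimage of k in [S j]; elsewhere [mu]
   sums to 1. *)
have marg (x' : D') : \sum_(X : {dffun forall j : J, D}) (agree x' X)%:R * \prod_j N j (X j) = 1.
  pose g j k (t : T k) : C := [forall (k' | k' \in S j), (f k' == k) ==>
    (Tagged T (x' k') == Tagged T t)]%:R * (if k \in f @: S j then 1 else mu k t).
  transitivity (\sum_(X : {dffun forall j : J, D}) \prod_j \prod_k g j k (X j k)).
    apply: eq_bigr => X _; rewrite /g; under [RHS]eq_bigr do rewrite big_split /=.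
    rewrite big_split; congr (_ * _).
    under [RHS]eq_bigr do rewrite prod_nat_bool.
    rewrite prod_nat_bool; congr (nat_of_bool _)%:R.
    apply/forallP/forallP => h j.
      apply/forallP => k; apply/forall_inP => k' k'S; apply/implyP => /eqP ek.
      by subst k; rewrite eq_Tagged /=; have /forall_inP := h j; apply.
    apply/forall_inP => k kS; have /forallP/(_ (f k))/forall_inP/(_ k kS) := h j.
    by rewrite eqxx eq_Tagged.
  rewrite -(dffun_distr (fun j (x : D) => \prod_k g j k (x k))) big1 // => j _.
  rewrite -(dffun_distr (g j)) big1 // => k _; rewrite /g.
  have [/imsetP [k' k'S ek]|kS] := boolP (k \in f @: S j).
    subst k; rewrite (bigD1 (x' k')) //= big1 ?addr0 => [|t /negPf ht].
      rewrite mulr1; case: forall_inP => // -[] k k_S; apply/implyP => /eqP ek.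
      by rewrite (f_inj j k k').
    rewrite mulr1; case: forall_inP => // /(_ k' k'S).
    by rewrite eqxx eq_Tagged /= eq_sym ht.
  rewrite -[RHS](mu1 k); apply: eq_bigr => t _.
  case: forall_inP => [_|[]]; first by rewrite mul1r.
  by move=> k' k'S; apply/implyP => /eqP ek; rewrite -ek imset_f in kS.
(* At k in some [S j] the value is forced to [X j (f k)], by a single j since the [S j] are
   disjoint; elsewhere [mu] sums to 1. *)
have marg' (X : {dffun forall j : J, D}) : \sum_(x' : D') (agree x' X)%:R * N' x' = 1.
  pose g k (t : T (f k)) : C := [forall j, (k \in S j) ==> (t == X j (f k))]%:R *
    (if [exists j, k \in S j] then 1 else mu (f k) t).
  transitivity (\sum_(x' : D') \prod_k g k (x' k)).
    apply: eq_bigr => x' _; rewrite /g big_split; congr (_ * _).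
    rewrite prod_nat_bool; congr (nat_of_bool _)%:R.
    apply/forallP/forallP => h k.
      by apply/forallP => j; apply/implyP => kS; have /forall_inP := h j; apply.
    by apply/forall_inP => j jS; have /forallP/(_ k)/implyP := h j; apply.
  rewrite -(dffun_distr g) big1 // => k _; rewrite /g.
  have [/existsP [j kS]|kS] := boolP [exists j, k \in S j].
    rewrite (bigD1 (X j (f k))) //= big1 ?addr0 => [|t /negPf ht].
      rewrite mulr1; case: forallP => // -[] i; apply/implyP => iS.
      by rewrite (S_disj i j k).
    by rewrite mulr1; case: forallP => // /(_ j); rewrite kS ht.
  rewrite -[RHS](mu1 (f k)); apply: eq_bigr => t _.
  case: forallP => [_|[]]; first by rewrite mul1r.
  by move=> j; apply/implyP => jS; case/existsP: kS; exists j.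
rewrite (dffun_distr (fun j x => M j x * N j x)).
transitivity (\sum_(x' : D') \sum_(X : {dffun forall j : J, D})
  (agree x' X)%:R * (M' x' * N' x' * \prod_j N j (X j))).
  apply: eq_bigr => x' _; rewrite -[LHS]mulr1 -[X in _ * X](marg x') mulr_sumr.
  by apply: eq_bigr => X _; rewrite mulrCA.
rewrite exchange_big; apply: eq_bigr => X _ /=.
rewrite big_split /= -[RHS]mulr1 -[Y in _ * Y](marg' X) mulr_sumr; apply: eq_bigr => x' _.
have [/forallP h|_] := boolP (agree x' X); last by rewrite !mul0r mulr0.
rewrite !mul1r mulrAC; congr (_ * _ * _); apply: eM => j k kS.
by apply/eqP; have /forall_inP := h j; apply.
Qed.

End Coupling.

(** * Ancestry of copies and of injectable sets *)

Section Injectable.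
Variables G' G : dag.

Definition latent_anc (H : dag) (U : {set vnode H}) : {set lnode H} :=
  [set L | inr L \in ancestral (vis U)].

Lemma mem_vis (H : dag) (U : {set vnode H}) A : (inl A \in vis U) = (A \in U).
Proof. by rewrite mem_imset // => x y []. Qed.

Lemma mem_ancestral_vis (H : dag) (U : {set vnode H}) A :
  A \in U -> inl A \in ancestral (vis U).
Proof.
by move=> AU; rewrite inE; apply/exists_inP; exists (inl A); rewrite ?mem_vis ?connect0.
Qed.

Lemma latent_anc_edge (H : dag) (U : {set vnode H}) L A :
  A \in U -> edge (inr L) (inl A) -> L \in latent_anc U.
Proof.
move=> AU LA; rewrite !inE; apply/exists_inP.
by exists (inl A); rewrite ?mem_vis // connect1.
Qed.

Variable f : copymap G' G.

Lemma inflation_edges : is_inflation f -> preserves_edges f.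
Proof.
move=> [_ sim] L A LA; have [_ _ _ _ hE] := sim (inl A).
rewrite (hE (inr L) (inl A)) // inE; apply/exists_inP.
  by exists (inl A); rewrite ?inE // connect1.
by exists (inl A); rewrite ?inE // connect0.
Qed.

(** Parents lie in the ancestral subgraph of a single node, which is isomorphic to that of its copy.
    With [inflation_parent_inj] this gives a bijection between parents. *)
Lemma inflation_parent A L : is_inflation f -> L \in Pa (onV f A) ->
  exists2 L', L' \in Pa A & onL f L' = L.
Proof.
move=> [_ sim]; rewrite inE => LA; have [_ _ _ eA hE] := sim (inl A).
have : inr L \in ancestral [set drop_copy f (inl A)].
  by rewrite inE; apply/exists_inP; exists (inl (onV f A)); rewrite ?inE // connect1.
rewrite -eA => /imsetP [[//|L'] L'anc /= [eL]]; exists L' => //.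
rewrite inE -(hE (inr L') (inl A)) //=; first by rewrite -eL.
by rewrite inE; apply/exists_inP; exists (inl A); rewrite ?inE // connect0.
Qed.

Lemma inflation_parent_inj A : is_inflation f -> {in Pa A &, injective (onL f)}.
Proof.
move=> [_ sim] L1 L2; rewrite !inE => h1 h2 e12; have [_ _ iA _ _] := sim (inl A).
have anc L : edge (inr L) (inl A) -> inr L \in ancestral [set inl A].
  by move=> LA; rewrite inE; apply/exists_inP; exists (inl A); rewrite ?inE // connect1.
have : inr L1 = inr L2 :> node G' by apply: iA; rewrite ?anc //= e12.
by case.
Qed.

Variables (U' : {set vnode G'}) (U : {set vnode G}).
Hypothesis U'U : image_of f U' U.

Lemma image_of_inj : {in U' &, injective (onV f)}.
Proof.
case: U'U => iU _ _ _ _ A B AU BU eAB.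
have : inl A = inl B :> node G' by apply: iU; rewrite ?mem_vis //= eAB.
by case.
Qed.

Lemma image_ofE : onV f @: U' = U.
Proof.
case: U'U => _ eU _ _ _; apply/setP => B; rewrite -[RHS]mem_vis -eU.
apply/imsetP/imsetP => [[A AU ->]|[[A|//]]].
  by exists (inl A); rewrite ?mem_vis.
by rewrite mem_vis => AU [->]; exists A.
Qed.

Lemma latent_anc_inj : {in latent_anc U' &, injective (onL f)}.
Proof.
case: U'U => _ _ iA _ _ L1 L2; rewrite !in_set => h1 h2 e12.
have : inr L1 = inr L2 :> node G' by apply: iA; rewrite //= ?e12 // in_set.
by case.
Qed.

(** Edges inside the ancestral subgraph are preserved both ways, so [L] and its image keep
    corresponding systems in the partial trace. *)
Lemma image_Ch L : L \in latent_anc U' -> onV f @: (Ch L :&: U') = Ch (onL f L) :&: U.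
Proof.
case: U'U => _ _ _ _ hE; rewrite in_set => LU.
rewrite -image_ofE; apply/setP => B; rewrite !inE; apply/imsetP/andP.
  case=> A; rewrite !inE => /andP[LA AU] ->; split; last exact: imset_f.
  by rewrite (hE (inr L) (inl A)) // mem_ancestral_vis.
case=> LB /imsetP [A AU eB]; exists A => //; rewrite !inE AU andbT; subst B.
by rewrite -(hE (inr L) (inl A)) // mem_ancestral_vis.
Qed.

(** A latent with a child in [U] is an ancestor of [U], hence the image of an ancestor of [U']. *)
Lemma Ch_image0 L : L \notin onL f @: latent_anc U' -> Ch L :&: U = set0.
Proof.
case: U'U => _ _ _ eA _ LU; apply/setP => B; rewrite !inE; apply: contraNF LU.
move=> /andP[LB BU]; have : L \in latent_anc U by apply: latent_anc_edge LB.
rewrite in_set -eA => /imsetP [[//|L'] L'U /= [->]].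
by apply: imset_f; rewrite in_set.
Qed.

End Injectable.

(** * Factorization of the induced model and compatibility *)

Section Main.
Variable C : numClosedFieldType.

(** Injective because each parent of [onV f A] has a copy above [A]; surjective because moreover
    that copy is unique. *)
Lemma in_pull_bij (G' G : dag) (f : copymap G' G) (f_edge : preserves_edges f)
    (dl : lnode G -> vnode G -> nat) (A : vnode G') :
  is_inflation f -> bijective (@in_pull G' G f f_edge dl A).
Proof.
move=> inf; set h := @in_pull _ _ _ _ _ _.
have h_inj : injective h.
  move=> s s' /ffunP es; apply/ffunP => -[L LA].
  have [L' L'A eL] := inflation_parent inf LA; subst L.
  by have := es (exist _ L' L'A); rewrite !ffunE /= (bool_irrelevance (Pa_copy _ _) LA).
have h_surj t : exists s, h s = t.
  (* Equality is stated in nat, as onL f L' = val L is only propositional. *)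
  have : forall L : {L : lnode G | L \in Pa (onV f A)},
      exists v : 'I_(dl (val L) (onV f A)), forall L' (L'A : L' \in Pa A),
        onL f L' = val L -> v = t (exist (fun M => M \in Pa A) L' L'A) :> nat.
    move=> [L LA] /=; have [L' L'A eL] := inflation_parent inf LA; subst L.
    exists (t (exist (fun M => M \in Pa A) L' L'A)) => L2 L2A e2.
    have e : L2 = L' by apply: (inflation_parent_inj (A := A) inf).
    by subst L2; rewrite (bool_irrelevance L2A L'A).
  move=> /fin_all_exists [v vE]; exists [ffun L => v L].
  apply/ffunP => -[L' L'A]; rewrite !ffunE; apply: val_inj => /=.
  exact: (vE (exist _ _ _) L' L'A).
have [g gE] := fin_all_exists h_surj.
by exists g => // s; apply: h_inj; rewrite gE.
Qed.

Lemma copy_channel_is_channel (G' G : dag) (f : copymap G' G)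
    (f_edge : preserves_edges f) (dl : lnode G -> vnode G -> nat) (d : vnode G -> nat)
    (E : forall A : vnode G, {linear op C (paidx dl A) -> op C 'I_(d A)}) :
  is_inflation f -> (forall A, is_channel (E A)) ->
  forall A, is_channel (copy_channel f_edge E A).
Proof.
move=> inf hE A; have [cpE tpE] := hE (onV f A); split.
  exact: completely_positive_relabel.
by apply: trace_preserving_relabel => //; apply: in_pull_bij.
Qed.

(** Presents the model on [G] as an induced model, so that [copy_output_reduced] expands both sides
    of [copy_output_factor]. *)
Definition id_copy (G : dag) : copymap G G := CopyMap id id.

Lemma id_copy_edges (G : dag) : preserves_edges (id_copy G).
Proof. by []. Qed.

Lemma out_pull_id (G : dag) (dl : lnode G -> vnode G -> nat) L (z : chidx dl L) :
  out_pull (@id_copy_edges G) z = z.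
Proof.
by apply/ffunP => -[A AL]; rewrite ffunE;
  congr (z (exist _ _ _)); exact: bool_irrelevance.
Qed.

Lemma in_pull_id (G : dag) (dl : lnode G -> vnode G -> nat) A (s : paidx dl A) :
  in_pull (@id_copy_edges G) s = s.
Proof.
by apply/ffunP => -[L LA]; rewrite ffunE;
  congr (s (exist _ _ _)); exact: bool_irrelevance.
Qed.

Lemma tensor_op_ext (K : finType) (T : K -> finType) (A B : forall k, op C (T k)) :
  (forall k, A k = B k) -> tensor_op A = tensor_op B.
Proof. by move=> e; apply: entP => m n; rewrite !opmxE; under eq_bigr do rewrite e. Qed.

Lemma tensor_map_ext (K : finType) (S T : K -> finType)
    (E F : forall k, op C (S k) -> op C (T k)) X :
  (forall k, E k =1 F k) -> tensor_map E X = tensor_map F X.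
Proof.
move=> e; apply: eq_bigr => i _; apply: eq_bigr => i' _; congr (_ *: _).
by apply: tensor_op_ext => k; apply: e.
Qed.

Lemma copy_output_id (G : dag) (dl : lnode G -> vnode G -> nat) (d : vnode G -> nat)
    (rhoL : forall L, op C (chidx dl L))
    (E : forall A : vnode G, {linear op C (paidx dl A) -> op C 'I_(d A)}) :
  copy_output (@id_copy_edges G) rhoL E =
  tensor_map (T := fun A => 'I_(d A)) (fun A => E A)
    (relabel (@regroup G dl) (tensor_op rhoL)).
Proof.
rewrite /copy_output; have -> : tensor_op (copy_state (@id_copy_edges G) rhoL) = tensor_op rhoL.
  apply: tensor_op_ext => L; apply: entP => z z'; rewrite opmxE.
  rewrite (bigD1 z) //= [X in _ + X]big1 ?addr0 => [|c /negPf hc]; last first.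
    by apply: big1 => c' _; rewrite out_pull_id hc !mul0r.
  rewrite (bigD1 z') //= [X in _ + X]big1 ?addr0 => [|c /negPf hc]; last first.
    by rewrite !out_pull_id hc mulr0 mul0r.
  rewrite !out_pull_id !eqxx !mul1r /weight; case: agree_offP => [_|[]]; rewrite ?mulr1 //.
  by move=> B BL; rewrite imset_id BL.
apply: tensor_map_ext => A X /=; congr (E A _).
by apply: entP => s s'; rewrite opmxE !in_pull_id.
Qed.

Section Factorization.
Variables (G' G : dag) (f : copymap G' G) (f_edge : preserves_edges f).
Variables (dl : lnode G -> vnode G -> nat) (d : vnode G -> nat).
Variable rhoL : forall L, op C (chidx dl L).
Variable E : forall A : vnode G, {linear op C (paidx dl A) -> op C 'I_(d A)}.
Hypothesis inf : is_inflation f.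
Hypothesis nf : nonfanout f.
Hypothesis rhoL_state : forall L, is_state (rhoL L).
Hypothesis E_channel : forall A, is_channel (E A).

Local Notation id_edges := (@id_copy_edges G).

(** The input of [A] depends only on the emissions of its parents, and the bijection [in_pull]
    carries matrix units to matrix units. *)
Lemma copy_channel_received (A : vnode G')
    (Z1 Z2 : {dffun forall L : lnode G', chidx dl (onL f L)})
    (X1 X2 : {dffun forall L : lnode G, chidx dl L}) :
  (forall L, L \in Pa A -> Z1 L = X1 (onL f L)) ->
  (forall L, L \in Pa A -> Z2 L = X2 (onL f L)) ->
  copy_channel f_edge E A (delta_mx (enum_rank (received f_edge Z1 A))
                                    (enum_rank (received f_edge Z2 A))) =
  copy_channel id_edges E (onV f A)
    (delta_mx (enum_rank (received id_edges X1 (onV f A)))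
              (enum_rank (received id_edges X2 (onV f A)))).
Proof.
have emit (Z : {dffun forall L : lnode G', chidx dl (onL f L)})
    (X : {dffun forall L : lnode G, chidx dl L}) :
    (forall L, L \in Pa A -> Z L = X (onL f L)) ->
    received f_edge Z A = in_pull f_edge (received id_edges X (onV f A)).
  move=> e; apply/ffunP => -[L LA]; rewrite !ffunE /= e //.
  by congr (X _ (exist _ _ _)); apply: bool_irrelevance.
move=> /emit -> /emit -> /=; congr (E _ _).
rewrite relabel_delta; last exact/bij_inj/in_pull_bij.
by rewrite -[in RHS](in_pull_id (received id_edges X1 _))
  -[in RHS](in_pull_id (received id_edges X2 _))
  relabel_delta // => s s'; rewrite !in_pull_id.
Qed.

(** Both sides are sums over emissions to which [sum_coupling] applies, with [S j] the latent
    ancestors of component j and [mu] the fully traced weight. Each [kD j] transports [k] along the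
    copy map and is arbitrary elsewhere. *)
Lemma copy_output_factor (Y : {set vnode G'}) (D : decomposition f Y)
    (k k' : fullidx (copydim f d)) (kD kD' : 'I_(ncomp D) -> fullidx d) :
  (forall j A, A \in component j -> kD j (onV f A) = k A) ->
  (forall j A, A \in component j -> kD' j (onV f A) = k' A) ->
  ent (reduced Y (copy_output f_edge rhoL E)) (restr_full Y k) (restr_full Y k') =
  \prod_(j < ncomp D) ent (reduced (comp_image j) (copy_output id_edges rhoL E))
     (restr_full (comp_image j) (kD j)) (restr_full (comp_image j) (kD' j)).
Proof.
move=> ekD ekD'; rewrite copy_output_reduced //; last first.
  by move=> A; have [] := copy_channel_is_channel f_edge inf E_channel A.
pose T L : finType := (chidx dl L * chidx dl L)%type.
pose S j := latent_anc (component (d := D) j).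
pose mu L (t : T L) := weight rhoL set0 t.1 t.2.
rewrite sum_dffun_pair.
under [RHS]eq_bigr => j _.
  rewrite copy_output_reduced //; last first.
    move=> A; have [cpE tpE] := E_channel A; apply: trace_preserving_relabel tpE.
    by exists id => s; apply: in_pull_id.
  rewrite sum_dffun_pair; over.
have S_disj i j L : L \in S i -> L \in S j -> i = j.
  rewrite in_set => Li; rewrite in_set => Lj; apply/eqP; apply: contraT => /disjoint_component.
  by move/disjointFr => /(_ _ Li); rewrite Lj.
have covY A : (A \in Y) = (A \in \bigcup_j component (d := D) j).
  exact: (congr1 (fun W : {set vnode G'} => A \in W) (cover_component D)).
have disj_comp i j : i != j -> [disjoint component (d := D) i & component (d := D) j].
  move=> /disjoint_component disj; apply/pred0P => A /=; apply/negP => /andP[Ai Aj].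
  by have := disjointFr disj (mem_ancestral_vis Ai); rewrite mem_ancestral_vis.
pose wY (x : {dffun forall L : lnode G', T (onL f L)}) L :=
  weight rhoL (onV f @: (Ch L :&: Y)) (x L).1 (x L).2.
pose chY (x : {dffun forall L : lnode G', T (onL f L)}) A := ent (copy_channel f_edge E A
  (delta_mx (enum_rank (received f_edge [ffun L => (x L).1] A))
            (enum_rank (received f_edge [ffun L => (x L).2] A)))) (k A) (k' A).
pose wD j (x : {dffun forall L, T L}) L :=
  weight rhoL (Ch L :&: comp_image (d := D) j) (x L).1 (x L).2.
pose chD j (x : {dffun forall L, T L}) A := ent (copy_channel id_edges E A
  (delta_mx (enum_rank (received id_edges [ffun L => (x L).1] A))
            (enum_rank (received id_edges [ffun L => (x L).2] A)))) (kD j A) (kD' j A).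
(* [M'] and [M] collect the factors of the nodes in and above the components; all other latents are
   left to [mu]. *)
pose M' x := (\prod_L (if [exists j, L \in S j] then wY x L else 1)) * \prod_(A in Y) chY x A.
pose M j x := (\prod_L (if L \in onL f @: S j then wD j x L else 1)) *
  \prod_(A in comp_image (d := D) j) chD j x A.
(* A latent above no component has no child in [Y], so its weight is [mu]. *)
transitivity (\sum_x M' x * \prod_L (if [exists j, L \in S j] then 1 else mu (onL f L) (x L))).
  apply: eq_bigr => x _; rewrite /M' mulrAC -big_split /=; congr (_ * _).
  apply: eq_bigr => L _; rewrite !ffunE; case: ifPn => LS; first by rewrite mulr1.
  rewrite mul1r /mu; suff -> : Ch L :&: Y = set0 by rewrite imset0.
  apply/setP => A; rewrite !inE; apply: contraNF LS => /andP[LA].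
  rewrite covY => /bigcupP [j _ Aj]; apply/existsP; exists j.
  exact: latent_anc_edge LA.
rewrite (@sum_coupling _ _ _ _ _ T S mu M' M) //; first last.
- move=> x X eX; rewrite /M' /M big_split /=; congr (_ * _).
    under [RHS]eq_bigr => j _.
      rewrite -big_mkcond /= big_imset /=; last exact: latent_anc_inj (comp_imageP j).
      over.
    rewrite -big_mkcond (eq_bigl (mem (\bigcup_j S j))) => [|L]; last first.
      by apply/existsP/bigcupP => [[j jL]|[j _ jL]]; exists j.
    rewrite partition_disjoint_bigcup => [|i j]; last first.
      move=> nij; apply/pred0P => L /=; apply/negP => /andP[Li Lj].
      by rewrite (S_disj i j L) ?eqxx in nij.
    apply: eq_bigr => j _; apply: eq_bigr => L LS.
    rewrite /wY /wD (eX j) // -(image_Ch (comp_imageP j) LS).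
    (* A child of [L] in another component would put [L] in two disjoint ancestral subgraphs. *)
    suff -> : Ch L :&: Y = Ch L :&: component j by [].
    apply/setP => A; rewrite !in_setI.
    case: (boolP (A \in Ch L)) => //= LA; rewrite covY.
    apply/bigcupP/idP => [[i _ Ai]|Aj]; last by exists j.
    rewrite (S_disj j i L) //; apply: latent_anc_edge Ai _.
    by rewrite inE in LA.
  rewrite (eq_bigl _ _ covY) partition_disjoint_bigcup //; apply: eq_bigr => j _.
  rewrite -(image_ofE (comp_imageP j)) big_imset /=; last exact: image_of_inj (comp_imageP j).
  apply: eq_bigr => A Aj; rewrite /chY /chD ekD // ekD' //.
  have PaS L : L \in Pa A -> L \in S j.
    by rewrite inE; apply: latent_anc_edge.
  pose X1 : {dffun forall L : lnode G, chidx dl L} := [ffun L => (X j L).1].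
  pose X2 : {dffun forall L : lnode G, chidx dl L} := [ffun L => (X j L).2].
  rewrite (@copy_channel_received A _ _ X1 X2) //.
    by move=> L /PaS LS; rewrite !ffunE (eX j).
  by move=> L /PaS LS; rewrite !ffunE (eX j).
- by move=> L; rewrite -[RHS](weight0_sum (proj2 (rhoL_state L))) pair_bigA.
- by move=> j; apply: latent_anc_inj (comp_imageP j).
(* The same split on [G]: outside the image of [S j] a latent has no child in the image of component
   j. *)
apply: eq_bigr => j _; apply: eq_bigr => x _; rewrite /M mulrAC -big_split /=; congr (_ * _).
apply: eq_bigr => L _; rewrite !ffunE imset_id /mu /wD; case: ifPn => LS.
  by rewrite mulr1.
by rewrite mul1r (Ch_image0 (comp_imageP j) LS).
Qed.

Lemma copy_output_is_state (k : fullidx (copydim f d)) :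
  is_state (copy_output f_edge rhoL E).
Proof.
have chE := copy_channel_is_channel f_edge inf E_channel.
split.
  apply: tensor_map_psd => [A|]; first by have [] := chE A.
  apply: relabel_psd; apply: tensor_op_psd => L.
  by have [] := copy_state_is_state f_edge (rhoL_state (onL f L)).
(* The trace is the marginal on the empty set, where only the product of the [weight0_sum] terms
   remains; [k] names its single index. *)
transitivity (ent (reduced set0 (copy_output f_edge rhoL E))
  (restr_full set0 k) (restr_full set0 k)).
  rewrite reduced_restr mxtrace_ent; apply: eq_bigr => m _.
  rewrite (bigD1 m) //= [X in _ + X]big1 ?addr0 => [|n nm].
    by rewrite big1 ?mulr1 // => a _; rewrite inE eqxx.
  have [a nma] : exists a, n a != m a.
    apply/existsP; apply: contraNT nm; rewrite negb_exists => /forallP e.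
    by apply/eqP/ffunP => a; apply/eqP; rewrite -[_ == _]negbK e.
  by rewrite (bigD1 a) //= inE eq_sym (negPf nma) mul0r mulr0.
rewrite copy_output_reduced //; last by move=> A; have [] := chE A.
under eq_bigr do under eq_bigr do rewrite big_set0 mulr1.
rewrite -(dffun_distr2 (fun L z z' => weight rhoL (onV f @: (Ch L :&: set0)) z z')).
by apply: big1 => L _; rewrite setI0 imset0 (weight0_sum (proj2 (rhoL_state _))).
Qed.

End Factorization.

(** On the zero space the trace would be 0. The index obtained supplies default coordinates. *)
Lemma fullidx_inhabited (V : finType) (d : V -> nat) (A : op C (fullidx d)) :
  is_state A -> inhabited (fullidx d).
Proof.
case=> _; rewrite mxtrace_ent; case: (pickP (@predT (fullidx d))) => [k|e] //.
rewrite big1 => [/esym/eqP|k]; first by rewrite oner_eq0.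
by have := e k.
Qed.

Lemma restr_full_surj (V : finType) (d : V -> nat) (k0 : fullidx d) (X : {set V})
    (m : sidx d X) : exists k, restr_full X k = m.
Proof.
have : forall a, exists v : 'I_(d a), forall aX : a \in X, v = m (exist _ a aX).
  move=> a; have /orP[aX|/negP naX] := orbN (a \in X); last by exists (k0 a) => aX; case: naX.
  by exists (m (exist _ a aX)) => aX'; rewrite (bool_irrelevance aX aX').
move=> /fin_all_exists [v vE]; exists [ffun a => v a].
by apply/ffunP => -[a aX]; rewrite !ffunE (vE a aX).
Qed.

Lemma image_of_fullidx (G' G : dag) (f : copymap G' G) (d : vnode G -> nat) U' U
    (k0 : fullidx d) (k : fullidx (copydim f d)) : image_of f U' U ->
  exists kU : fullidx d, forall A, A \in U' -> kU (onV f A) = k A.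
Proof.
move=> U'U.
(* Off the image of [U'] the default [k0 B] is used. Values are compared in nat because
   [onV f A = B] is only propositional. *)
have : forall B, exists v : 'I_(d B), forall A, A \in U' -> onV f A = B -> v = k A :> nat.
  move=> B; have [/imsetP [A AU ->]|BU] := boolP (B \in onV f @: U').
    by exists (k A) => A2 A2U /(image_of_inj U'U A2U AU) ->.
  by exists (k0 B) => A AU eB; rewrite -eB imset_f in BU.
move=> /fin_all_exists [v vE]; exists [ffun B => v B] => A AU.
by rewrite ffunE; apply: val_inj; apply: (vE _ A).
Qed.

Lemma inflation_compatible (G G' : dag) (f : copymap G' G) (d : vnode G -> nat)
    (rho : forall U : {set vnode G}, images_injectable f U -> op C (sidx d U))
    (D : forall Y : {set vnode G'}, expressible f Y -> decomposition f Y) :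
  is_inflation f -> nonfanout f -> compatible_family rho ->
  compatible_family (G := G') (d := copydim f d) (P := expressible f)
    (fun Y hY => product_op rho (D Y hY)).
Proof.
move=> inf nf [rho0 [rho0_state [dl [rhoL [E [rhoL_state E_channel eq_rho0]]]] red_rho0]].
have f_edge := inflation_edges inf.
have [k0] := fullidx_inhabited rho0_state.
pose k0' : fullidx (copydim f d) := [ffun A => k0 (onV f A)].
exists (copy_output f_edge rhoL E); split.
- exact: copy_output_is_state k0'.
- exists (copy_dl f dl), (copy_state f_edge rhoL), (copy_channel f_edge E); split => //.
    by move=> L; apply: copy_state_is_state.
  exact: copy_channel_is_channel.
move=> Y hY; apply: entP => m n.
have [k <-] := restr_full_surj k0' m; have [k' <-] := restr_full_surj k0' n.
have [kD ekD] := fin_all_exists (fun j => image_of_fullidx k0 k (comp_imageP (d := D Y hY) j)).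
have [kD' ekD'] := fin_all_exists (fun j => image_of_fullidx k0 k' (comp_imageP (d := D Y hY) j)).
rewrite (copy_output_factor f_edge inf nf rhoL_state E_channel ekD ekD') opmxE.
(* The model along the identity is [rho0] itself, whose marginals are the given states. *)
apply: eq_bigr => j _; rewrite copy_output_id -eq_rho0 (red_rho0 _ (comp_image_in j)).
(* Restricting [q] to component j is pulling back the restriction of [qD] to the image, the form in
   which [on_copiesE] applies. *)
have pull (q : fullidx (copydim f d)) (qD : fullidx d) :
    (forall A, A \in component j -> qD (onV f A) = q A) ->
    restr (comp_sub j) (restr_full Y q) =
    image_pull (comp_imageP j) (restr_full (comp_image (d := D Y hY) j) qD).
  by move=> eq; apply/ffunP => -[A Aj]; rewrite !ffunE /= eq.
by rewrite (pull k (kD j)) ?(pull k' (kD' j)) ?on_copiesE //; [apply: ekD'|apply: ekD].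
Qed.

End Main.

Local Open Scope complex_scope.

Theorem proposition1 (R : realType) (G G' : dag) (f : copymap G' G)
    (d : vnode G -> nat)
    (rho : forall U : {set vnode G},
             images_injectable f U -> op R[i] (sidx d U))
    (D : forall Y : {set vnode G'}, expressible f Y -> decomposition f Y) :
  is_network G -> is_inflation f -> nonfanout f ->
  (forall (U : {set vnode G}) (hU : images_injectable f U),
     is_state (rho U hU)) ->
  compatible_family rho ->
  compatible_family (G := G') (d := copydim f d) (P := expressible f)
    (fun (Y : {set vnode G'}) (hY : expressible f Y) =>
       product_op rho (D Y hY)).
Proof.
move=> _ inf nf _; exact: inflation_compatible.
Qed.
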